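(* Let $p$ be a prime number and let \[T(p):=\frac{1}{5}\left( (1+\sqrt{5}) \left( \frac{3+\sqrt{5}}{2} \right)^{2p}+(1-\sqrt{5}) \left( \frac{3-\sqrt{5}}{2} \right)^{2p}+3\right),\] which is an integer. Then: (1) if $p \equiv 7 \pmod{65}$, then $T(p)$ is divisible by $131$; (2) if $p \equiv 29 \pmod{35}$, then $T(p)$ is divisible by $71$. *)

(* Defs.v *)
From HB Require Import structures.
From mathcomp Require Import all_boot all_order all_algebra.

Set Implicit Arguments.
Unset Strict Implicit.
Unset Printing Implicit Defensive.

Import Order.TTheory GRing.Theory Num.Theory.

Local Open Scope ring_scope.

(* The value lives in a real closed field; the real numbers are an instance,
   and the square root of 5 is the positive one. *)
Definition T (R : rcfType) (p : nat) : R :=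
  5%:R^-1 *
  ((1 + Num.sqrt 5%:R) * ((3%:R + Num.sqrt 5%:R) / 2%:R) ^+ (2 * p)
   + (1 - Num.sqrt 5%:R) * ((3%:R - Num.sqrt 5%:R) / 2%:R) ^+ (2 * p)
   + 3%:R).

(* Main.v *)
(* [T] satisfies [T 0 = 1], [T 1 = 5] and [T (n + 2) = 7 T (n + 1) - T n - 3],
   because ((3 + sqrt 5) / 2)^2 and ((3 - sqrt 5) / 2)^2 are the roots of
   X^2 - 7 X + 1; hence its values are integers.  Modulo 131 this recurrence has
   period 65 and vanishes at 7; modulo 71 it has period 35 and vanishes at 29. *)
Require Import Defs.
From HB Require Import structures.
From mathcomp Require Import all_boot all_order all_algebra.
From mathcomp Require Import ring.

Set Implicit Arguments.
Unset Strict Implicit.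
Unset Printing Implicit Defensive.

Import Order.TTheory GRing.Theory Num.Theory.

Local Open Scope ring_scope.

Definition T_step (A : comNzRingType) (x : A * A) : A * A :=
  (x.2, 7%:R * x.2 - x.1 - 3%:R).

(** The ring is a parameter so that one recurrence runs in [R], in [int] and in ['F_q], linked by
    morphisms. *)
Definition T_pair (A : comNzRingType) (n : nat) : A * A :=
  iter n (@T_step A) (1, 5%:R).

Lemma rmorph_T_pair (A B : comNzRingType) (f : {rmorphism A -> B}) (n : nat) :
  T_pair B n = (f (T_pair A n).1, f (T_pair A n).2).
Proof.
elim: n => [|n IHn]; first by rewrite /= rmorph1 rmorph_nat.
rewrite [LHS]iterS -/(T_pair B n) IHn /T_step /=.
by rewrite !rmorphB rmorphM !rmorph_nat.
Qed.

(** Each pair determines the next, so a return to the initial pair after [m] steps makes the orbit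
    periodic. *)
Lemma T_pair_periodic (A : comNzRingType) (m k n : nat) :
  T_pair A m = T_pair A 0 -> n = k %[mod m] -> T_pair A n = T_pair A k.
Proof.
move=> per; suff modE j : T_pair A j = T_pair A (j %% m) by rewrite modE => ->.
rewrite {1}(divn_eq j m) addnC /T_pair iterD; congr (iter _ _ _).
by elim: (j %/ m)%N => // i IHi; rewrite mulSn iterD IHi.
Qed.

Lemma T_recurrence (R : rcfType) (n : nat) :
  T R n.+2 = 7%:R * T R n.+1 - T R n - 3%:R.
Proof.
have s2 : Num.sqrt 5%:R ^+ 2 = 5%:R :> R by rewrite sqr_sqrtr ?ler0n.
rewrite /T !mul2n !doubleS.
set s := Num.sqrt 5%:R in s2 *.
set a := (3%:R + s) / 2%:R; set b := (3%:R - s) / 2%:R.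
have a2 : a ^+ 2 = 3%:R * a - 1 by rewrite /a; field: s2.
have b2 : b ^+ 2 = 3%:R * b - 1 by rewrite /b; field: s2.
(* Once the even powers are generalized, an identity modulo the quadratic relations [a2] and [b2]
   remains. *)
rewrite !exprS; move: (a ^+ n.*2) (b ^+ n.*2) => u v.
by field: a2 b2.
Qed.

Lemma T_pairE (R : rcfType) (n : nat) : T_pair R n = (T R n, T R n.+1).
Proof.
elim: n => [|n IHn]; last first.
  by rewrite [LHS]iterS -/(T_pair R n) IHn /T_step /= T_recurrence.
have s2 : Num.sqrt 5%:R ^+ 2 = 5%:R :> R by rewrite sqr_sqrtr ?ler0n.
rewrite /T_pair /T /=; congr pair; rewrite ?muln0 ?expr0; first by field.
by field: s2.
Qed.

(** Divisibility by [q] means vanishing in ['F_q], where the period and the zero can be computed. *)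
Lemma dvdz_T_pair (q m k n : nat) : prime q ->
    T_pair 'F_q m = T_pair 'F_q 0 -> (T_pair 'F_q k).1 = 0 ->
  n = k %[mod m] -> (q %| (T_pair int n).1)%Z.
Proof.
move=> q_pr per zero /(T_pair_periodic per) nk.
rewrite (dvdz_pcharf (pchar_Fp q_pr)).
by move: zero; rewrite -nk (rmorph_T_pair intr) /= => ->.
Qed.

Theorem theorem3 (R : rcfType) (p : nat) (hp : prime p) :
  exists z : int,
    [/\ T R p = z%:~R,
        p = 7 %[mod 65] -> (131 %| z)%Z
      & p = 29 %[mod 35] -> (71 %| z)%Z].
Proof.
exists (T_pair int p).1; split.
- by have := @rmorph_T_pair int R intr p; rewrite T_pairE => -[].
(* The period and the zero are checked by evaluation in ['F_131]. *)
- by apply: (@dvdz_T_pair 131) => //; apply/eqP; vm_compute.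
- by apply: (@dvdz_T_pair 71) => //; apply/eqP; vm_compute.
Qed.
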